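(* Let $\mu$ be a real constant and let $g$ be the pseudo-Riemannian metric $$g=\mu\left(dx^{2}+dy^{2}+dx\,dy\right)+e^{-y}\left(2\,dx+dy\right)dv+e^{-x}\left(dx+2\,dy\right)du$$ on $\mathbb{R}^{4}$ with global coordinates $(x,y,u,v)$, that is, the invariant metric of a four-dimensional proper generalized symmetric space of type $B$. Then $(\mathbb{R}^{4},g)$ is a Ricci soliton if and only if $\mu\neq0$. More precisely: (1) If $\mu=0$, there are no smooth vector field $X$ on $\mathbb{R}^{4}$ and real constant $\lambda$ such that $\mathcal{L}_{X}g+\varrho=\lambda g$, where $\varrho$ is the Ricci tensor of $g$. (2) If $\mu\neq0$, then for all real constants $W^{1},W^{2},W^{3}$ the vector field $$X=\left(-W^{1}+2W^{2}\right)\left(\frac{\partial}{\partial x}+u\frac{\partial}{\partial u}\right)+\left(2W^{1}-W^{2}\right)\left(\frac{\partial}{\partial y}+v\frac{\partial}{\partial v}\right)-\frac{4}{3\mu}\left(u\frac{\partial}{\partial u}+v\frac{\partial}{\partial v}\right)+W^{3}\frac{\partial}{\partial v}$$ (where $W^{1},W^{2},W^{3}$ carry upper indices, not exponents) satisfies the Ricci soliton equation $\mathcal{L}_{X}g+\varrho=\lambda g$ for some real constant $\lambda$. This Ricci soliton is not a gradient one: there is no smooth function $f\colon\mathbb{R}^{4}\to\mathbb{R}$ with $X=\mathrm{grad}_g(f)$.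
   Context: A four-dimensional (proper) pseudo-Riemannian generalized symmetric space of type $B$, in the classification of Černý and Kowalski, is the space $\mathbb{R}^{4}(x,y,u,v)$ with the metric $g=\mu(dx^{2}+dy^{2}+dx\,dy)+e^{-y}(2dx+dy)dv+e^{-x}(dx+2dy)du$, where $\mu$ is a real constant. Products of one-forms are symmetric products, so a term $c\,d\xi\,d\eta$ with $\xi\neq\eta$ distinct coordinates contributes $c/2$ to $g(\partial_{\xi},\partial_{\eta})$; e.g. $g(\partial_x,\partial_x)=g(\partial_y,\partial_y)=\mu$, $g(\partial_x,\partial_y)=\mu/2$, $g(\partial_x,\partial_v)=e^{-y}$, $g(\partial_y,\partial_v)=\tfrac12 e^{-y}$, $g(\partial_x,\partial_u)=\tfrac12 e^{-x}$, $g(\partial_y,\partial_u)=e^{-x}$, and $g(\partial_u,\partial_u)=g(\partial_u,\partial_v)=g(\partial_v,\partial_v)=0$. All these metrics have neutral signature $(2,2)$. A Ricci soliton is a pseudo-Riemannian manifold $(M,g)$ together with a smooth vector field $X$ such that $\mathcal{L}_{X}g+\varrho=\lambda g$ for some real number $\lambda$, where $\mathcal{L}_{X}$ is the Lie derivative and $\varrho$ is the Ricci tensor. It is a gradient Ricci soliton if $X$ is the gradient (with respect to $g$) of some smooth function $f\colon M\to\mathbb{R}$. Sign conventions: $R(X,Y)=\nabla_{X}\nabla_{Y}-\nabla_{Y}\nabla_{X}-\nabla_{[X,Y]}$, with $\nabla$ the Levi-Civita connection, and $\varrho(X,Y)=\mathrm{tr}(Z\mapsto R(Z,X)Y)$.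 *)

(* Defs.v *)
From mathcomp Require Import all_boot all_order all_algebra.
From mathcomp Require Import all_classical all_reals all_analysis.
Set Implicit Arguments.
Unset Strict Implicit.
Unset Printing Implicit Defensive.
Import Order.TTheory GRing.Theory Num.Theory.
Import numFieldNormedType.Exports.
Local Open Scope classical_set_scope.
Local Open Scope ring_scope.

(* Pseudo-Riemannian geometry on R^n in its global coordinates: points and
   tangent vectors are row vectors, a vector field is a map 'rV_n -> 'rV_n, and
   a (0,2)-tensor field is the map sending a point to its Gram matrix in the
   coordinate frame. *)
Section Geometry.
Context {R : realType} {n : nat}.
Implicit Types (f : 'rV[R]_n -> R) (g : 'rV[R]_n -> 'M[R]_n).
Implicit Types (X Y Z : 'rV[R]_n -> 'rV[R]_n) (p : 'rV[R]_n).

Definition partial (i : 'I_n) f : 'rV[R]_n -> R :=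
  fun p => 'D_(delta_mx 0 i) f p.

Fixpoint Ck (k : nat) f : Prop :=
  continuous f /\
  if k is k'.+1 then
    forall i : 'I_n, (forall p, derivable f p (delta_mx 0 i)) /\
                     Ck k' (partial i f)
  else True.

Definition smooth f : Prop := forall k, Ck k f.

Definition smooth_field X : Prop := forall i, smooth (fun p => X p 0 i).

Definition pseudo_riemannian g : Prop :=
  (forall i j, smooth (fun p => g p i j)) /\
  (forall p, (g p)^T = g p /\ g p \in unitmx).

Definition frame (i : 'I_n) : 'rV[R]_n -> 'rV[R]_n := fun=> delta_mx 0 i.

Definition inner g X Y : 'rV[R]_n -> R :=
  fun p => (X p *m g p *m (Y p)^T) 0 0.

(* [deriv X f] is the derivative X(f) of the function f along X. *)
Definition deriv X f : 'rV[R]_n -> R :=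
  fun p => \sum_(i < n) X p 0 i * partial i f p.

Definition bracket X Y : 'rV[R]_n -> 'rV[R]_n :=
  fun p => \row_k (deriv X (fun q => Y q 0 k) p - deriv Y (fun q => X q 0 k) p).

(* [christoffel g k i j] is Gamma^k_{ij} of the Levi-Civita connection. *)
Definition christoffel g (k i j : 'I_n) : 'rV[R]_n -> R :=
  fun p => 2^-1 * \sum_(l < n) invmx (g p) k l *
    (partial i (fun q => g q j l) p + partial j (fun q => g q i l) p
     - partial l (fun q => g q i j) p).

Definition nabla g X Y : 'rV[R]_n -> 'rV[R]_n :=
  fun p => \row_k (deriv X (fun q => Y q 0 k) p +
    \sum_(i < n) \sum_(j < n) christoffel g k i j p * X p 0 i * Y p 0 j).

Definition curvature g X Y Z : 'rV[R]_n -> 'rV[R]_n :=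
  fun p => nabla g X (nabla g Y Z) p - nabla g Y (nabla g X Z) p
           - nabla g (bracket X Y) Z p.

(* rho(X,Y) is the trace of Z |-> R(Z,X)Y; row k of the matrix is the image of
   the k-th coordinate vector. *)
Definition ricci g X Y : 'rV[R]_n -> R :=
  fun p => \tr (\matrix_(k < n) curvature g (frame k) X Y p).

Definition lie_metric g X Y Z : 'rV[R]_n -> R :=
  fun p => deriv X (inner g Y Z) p
           - inner g (bracket X Y) Z p - inner g Y (bracket X Z) p.

(* Characterised by g(grad f, Y) = Y(f). *)
Definition grad g f : 'rV[R]_n -> 'rV[R]_n :=
  fun p => (\row_i partial i f p) *m invmx (g p).

(* L_X g + rho = lambda g; all terms being tensorial, equality is tested on the
   coordinate frame at every point. *)
Definition ricci_soliton_eq g X (lambda : R) : Prop :=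
  forall p (i j : 'I_n),
    lie_metric g X (frame i) (frame j) p + ricci g (frame i) (frame j) p =
    lambda * inner g (frame i) (frame j) p.

Definition ricci_soliton g X : Prop :=
  [/\ pseudo_riemannian g, smooth_field X &
      exists lambda : R, ricci_soliton_eq g X lambda].

(* X is the gradient of a smooth function defined on all of R^n. *)
Definition gradient_field g X : Prop :=
  exists2 f, smooth f & forall p, X p = grad g f p.

(* The symmetric product (a b)(Y,Z) = (a(Y)b(Z) + a(Z)b(Y))/2 of one-forms,
   given by their rows of components. *)
Definition symprod (a b : 'rV[R]_n) : 'M[R]_n :=
  2^-1 *: (a^T *m b + b^T *m a).

End Geometry.

Definition ix : 'I_4 := @Ordinal 4 0 isT.
Definition iy : 'I_4 := @Ordinal 4 1 isT.
Definition iu : 'I_4 := @Ordinal 4 2 isT.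
Definition iv : 'I_4 := @Ordinal 4 3 isT.

Section TypeB.
Context {R : realType}.

Definition typeB_metric (mu : R) (p : 'rV[R]_4) : 'M[R]_4 :=
  let x := p 0 ix in let y := p 0 iy in
  let dx : 'rV[R]_4 := delta_mx 0 ix in let dy : 'rV[R]_4 := delta_mx 0 iy in
  let du : 'rV[R]_4 := delta_mx 0 iu in let dv : 'rV[R]_4 := delta_mx 0 iv in
  mu *: (symprod dx dx + symprod dy dy + symprod dx dy)
  + expR (- y) *: symprod (2 *: dx + dy) dv
  + expR (- x) *: symprod (dx + 2 *: dy) du.

Definition typeB_field (mu W1 W2 W3 : R) (p : 'rV[R]_4) : 'rV[R]_4 :=
  let u := p 0 iu in let v := p 0 iv in
  let ddx := frame ix p in let ddy := frame iy p in
  let ddu := frame iu p in let ddv := frame iv p in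
  (- W1 + 2 * W2) *: (ddx + u *: ddu)
  + (2 * W1 - W2) *: (ddy + v *: ddv)
  - (4 / (3 * mu)) *: (u *: ddu + v *: ddv)
  + W3 *: ddv.

End TypeB.

(* Main.v *)
(* In the frame E_i = e^{w_i} d_i with w = (0, 0, x, y) the metric has constant
   coefficients, so every Christoffel symbol is a constant times
   e^{w_k - w_i - w_j}, and the Ricci tensor is
   -(4/3) (dx^2 + dx dy + dy^2).  For mu <> 0 the field of the statement solves
   the soliton equation with lambda = - 4 / (3 mu).  It is not a gradient
   because its dual one-form is not closed: closedness in the planes (x,u),
   (y,u) and (x,v) would force 1 / mu = 0.
   For mu = 0 the restriction of g to span(dx, dy) vanishes, so the (x,x),
   (x,y) and (y,y) components of the equation only involve the first x- and
   y-derivatives of U = e^{-x} X^u and V = e^{-y} X^v, with lambda absent; this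
   overdetermined linear system violates the symmetry of second derivatives
   after two prolongations. *)
Require Import Defs.
From mathcomp Require Import all_boot all_order all_algebra.
From mathcomp Require Import all_classical all_reals all_analysis.
From mathcomp Require Import ring lra.
Import Order.TTheory GRing.Theory Num.Theory.
Import numFieldNormedType.Exports.
Local Open Scope ring_scope.

(** * Symmetry of second derivatives *)

Section Calculus.
Local Open Scope classical_set_scope.
Local Open Scope ring_scope.
Context {R : realType} {n : nat}.
Implicit Types (f h : 'rV[R]_n -> R) (p v : 'rV[R]_n).

(** Restriction to a line turns a directional derivative into a derivative in one real variable,
    where the mean value theorem and the chain rule for [expR] are available. [line_is_derive] is
    the way back, at parameter 0. *)
Lemma is_derive_line f p v (t df : R) : is_derive (t *: v + p) v f df ->
  is_derive t 1 (fun s => f (s *: v + p)) df.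
Proof.
have E : (fun h : R => h^-1 *: (f (h *: v + (t *: v + p)) - f (t *: v + p))) =
         (fun h : R => h^-1 *: (f ((h *: 1 + t) *: v + p) - f (t *: v + p))).
  by apply/funext => h; rewrite scalerDl -addrA [h *: 1]mulr1.
case=> dv <-; split.
- by move: dv; rewrite /derivable /= E.
- by rewrite /derive /= E.
Qed.

Lemma line_is_derive f p v (df : R) :
  is_derive (0 : R) 1 (fun s => f (s *: v + p)) df -> is_derive p v f df.
Proof.
have E : (fun h : R => h^-1 *: (f (h *: v + p) - f p)) =
         (fun h : R => h^-1 *: (f ((h *: 1 + 0) *: v + p) - f (0 *: v + p))).
  by apply/funext => h; rewrite scale0r add0r addr0 [h *: 1]mulr1.
case=> dv <-; split.
- by move: dv; rewrite /derivable /= -E.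
- by rewrite /derive /= -E.
Qed.

Lemma is_derive_coord i p v : is_derive p v (fun q : 'rV[R]_n => q 0 i) (v 0 i).
Proof.
apply: line_is_derive.
rewrite (_ : (fun s => _) = (fun s : R => s * v 0 i) + cst (p 0 i)); last first.
  by apply/funext => s; rewrite !mxE.
rewrite -[X in is_derive _ _ _ X]addr0.
apply: is_deriveD.
have := @is_deriveM R R^o id (cst (v 0 i)) 0 1 1 0 _ _.
rewrite scaler0 add0r [_ *: 1]mulr1 => H. exact: H.
Qed.

Lemma is_derive_expR_comp f p v (df : R) : is_derive p v f df ->
  is_derive p v (fun q => expR (f q)) (expR (f p) * df).
Proof.
move=> H; apply: line_is_derive.
have H1 : is_derive (0 : R) 1 (fun s => f (s *: v + p)) df.
  by apply: is_derive_line; rewrite scale0r add0r.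
have := @is_derive1_comp R expR (fun s => f (s *: v + p)) 0 _ _ _ H1.
rewrite scale0r add0r; apply.
Qed.


(** Two uses of the mean value theorem: first for the increment in direction v, as a function of the
    coefficient of u, then for ['D_u f] along v at the intermediate value a. *)
Lemma second_difference f p (u v : 'rV[R]_n) (h : R) : 0 < h ->
  (forall q, derivable f q u) -> (forall q, derivable ('D_u f) q v) ->
  exists a b : R, [/\ 0 <= a <= h, 0 <= b <= h &
    f (h *: u + (h *: v + p)) - f (h *: u + p) - (f (h *: v + p) - f p) =
    'D_v ('D_u f) (b *: v + (a *: u + p)) * h * h].
Proof.
move=> h0 fu fuv.
have cts (F dF : R -> R) : (forall s : R, is_derive s 1 F (dF s)) ->
    {within `[0, h], continuous F}.
  by move=> H; apply: derivable_within_continuous => s _; case: (H s).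
pose G s := f (s *: u + (h *: v + p)) - f (s *: u + p).
have dG (s : R) : is_derive s 1 G ('D_u f (s *: u + (h *: v + p)) - 'D_u f (s *: u + p)).
  by apply: is_deriveB; apply: is_derive_line; apply: derivableP.
have [a] := MVT h0 (fun s _ => dG s) (cts _ _ dG).
rewrite in_itv /= => /andP[a0 ah]; rewrite /G !scale0r !add0r subr0 => Ga.
pose K t := 'D_u f (t *: v + (a *: u + p)).
have dK (t : R) : is_derive t 1 K ('D_v ('D_u f) (t *: v + (a *: u + p))).
  have := derivableP (fuv (t *: v + (a *: u + p))). by apply: is_derive_line.
have [b] := MVT h0 (fun s _ => dK s) (cts _ _ dK).
rewrite in_itv /= => /andP[b0 bh]; rewrite /K !scale0r !add0r subr0 => Kb.
exists a, b; split; rewrite ?ltW //.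
by rewrite -Kb [h *: v + (a *: u + p)]addrCA -Ga.
Qed.

(** The second difference is symmetric in u and v. Hence the two mixed derivatives agree at two
    points, possibly different but both close to p, and continuity at p carries this over to p. *)
Lemma derive_comm f p (u v : 'rV[R]_n) :
  (forall q, derivable f q u) -> (forall q, derivable f q v) ->
  (forall q, derivable ('D_u f) q v) -> (forall q, derivable ('D_v f) q u) ->
  {for p, continuous ('D_v ('D_u f))} -> {for p, continuous ('D_u ('D_v f))} ->
  'D_v ('D_u f) p = 'D_u ('D_v f) p.
Proof.
move=> fu fv fuv fvu cuv cvu; apply/eqP; rewrite -subr_eq0 -normr_le0.
apply/ler_addgt0Pr => e e0; rewrite add0r.
have e20 : 0 < e / 2 by rewrite divr_gt0.
have [d d0 Hd] : exists2 d : R, 0 < d & forall q, `|p - q| < d ->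
    `|'D_v ('D_u f) p - 'D_v ('D_u f) q| < e / 2 /\
    `|'D_u ('D_v f) p - 'D_u ('D_v f) q| < e / 2.
  have /cvgrPdist_lt /(_ _ e20) H1 := cuv.
  have /cvgrPdist_lt /(_ _ e20) H2 := cvu.
  have [d /= d0 H] := (iffLR (nbhs_ballP _ _)) (filterI H1 H2).
  exists d => // q pq; have := H q; rewrite -ball_normE /ball_ /=.
  by move=> /(_ pq).
(* The added 1 makes N positive even when u = v = 0, and makes the distance bound h (|u| + |v|) < h
   N = d strict. *)
pose N := `|u| + `|v| + 1.
have N0 : 0 < N by rewrite ltr_wpDl ?addr_ge0.
pose h := d / N; have h0 : 0 < h by rewrite divr_gt0.
have cancel_p (V : zmodType) (x y z : V) : z - (x + (y + z)) = - (x + y).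
  by apply/eqP; rewrite subr_eq (addrA x) (addrA (- _)) addNr add0r.
have near_p a b (w z : 'rV[R]_n) : 0 <= a <= h -> 0 <= b <= h ->
    `|w| + `|z| + 1 = N -> `|p - (b *: w + (a *: z + p))| < d.
  move=> /andP[a0 ah] /andP[b0 bh] wz.
  have -> : p - (b *: w + (a *: z + p)) = - (b *: w + a *: z) by exact: cancel_p.
  rewrite normrN.
  apply: (@le_lt_trans _ _ (h * (`|w| + `|z|))).
    apply: le_trans (ler_normD _ _) _.
    by rewrite !normrZ !ger0_norm // mulrDr lerD // ler_wpM2r.
  have -> : d = h * N by rewrite /h mulfVK // gt_eqF.
  by rewrite -wz ltr_pM2l // ltrDl.
have [a [b [Ha Hb Eab]]] := second_difference f p u v h h0 fu fuv.
have [a' [b' [Ha' Hb' Eab']]] := second_difference f p v u h h0 fv fvu.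
(* Both sides times h^2 are the same second difference. *)
have E : 'D_v ('D_u f) (b *: v + (a *: u + p)) =
         'D_u ('D_v f) (b' *: u + (a' *: v + p)).
  have hn : h != 0 by rewrite gt_eqF.
  apply: (mulIf hn); apply: (mulIf hn).
  apply: (etrans (esym Eab)); apply: (etrans _ Eab').
  rewrite [h *: v + (_ + _)]addrCA !opprB addrACA [RHS]addrACA.
  by congr (_ + _); exact: addrC.
have [H1 _] := Hd _ (near_p _ _ v u Ha Hb (congr1 (+%R^~ 1) (addrC _ _))).
have [_ H2] := Hd _ (near_p _ _ u v Ha' Hb' erefl).
rewrite E in H1.
rewrite distrC in H2.
rewrite (splitr e).
apply: (le_trans (ler_distD ('D_u ('D_v f) (b' *: u + (a' *: v + p))) _ _)).
exact: (lerD (ltW H1) (ltW H2)).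
Qed.

(** * Smooth functions and their commuting partial derivatives *)

Lemma CkS k f : Ck k.+1 f -> Ck k f.
Proof.
elim: k f => [|k IH] f [cf df]; split=> // i.
by have [df1 df2] := df i; split=> //; apply: IH.
Qed.

Lemma Ck_continuous k f : Ck k f -> continuous f.
Proof. by case: k => [|k] []. Qed.

Lemma smooth_continuous f : smooth f -> continuous f.
Proof. by move/(_ 0%N)/Ck_continuous. Qed.

Lemma smooth_derivable f i p : smooth f -> derivable f p (delta_mx 0 i).
Proof. by move/(_ 1%N) => -[_ /(_ i)[]]. Qed.

Lemma smooth_partial f i : smooth f -> smooth (partial i f).
Proof. by move=> sf k; have [_ /(_ i)[]] := sf k.+1. Qed.

Lemma partialC f i j : smooth f ->
  partial i (partial j f) = partial j (partial i f).
Proof.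
move=> sf; apply/funext => p; apply: derive_comm => [q|q|q|q||].
- exact: smooth_derivable.
- exact: smooth_derivable.
- exact/smooth_derivable/smooth_partial.
- exact/smooth_derivable/smooth_partial.
- exact/smooth_continuous/smooth_partial/smooth_partial.
- exact/smooth_continuous/smooth_partial/smooth_partial.
Qed.

Lemma is_derive_partial f i p (df : R) :
  is_derive p (delta_mx 0 i) f df -> partial i f p = df.
Proof. by case. Qed.

Lemma partialD f h i p : smooth f -> smooth h ->
  partial i (fun q => f q + h q) p = partial i f p + partial i h p.
Proof. by move=> sf sh; apply: deriveD; apply: smooth_derivable. Qed.

End Calculus.

(** * Differentiation rules and closure properties of smooth functions *)

Section Smooth.
Context {R : realType} {n : nat}.
Implicit Types (f h : 'rV[R]_n -> R) (p v : 'rV[R]_n).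

Lemma partialM f h i p : smooth f -> smooth h ->
  partial i (fun q => f q * h q) p = f p * partial i h p + h p * partial i f p.
Proof. by move=> sf sh; apply: deriveM; apply: smooth_derivable. Qed.

Lemma partial_cst (c : R) i p : partial i (fun=> c) p = 0.
Proof. exact: derive_cst. Qed.

Lemma partial_coord i j p :
  partial i (fun q => q 0 j) p = (delta_mx 0 i : 'rV[R]_n) 0 j.
Proof. exact/is_derive_partial/is_derive_coord. Qed.

Lemma partial_expR f i p : smooth f ->
  partial i (fun q => expR (f q)) p = expR (f p) * partial i f p.
Proof.
move=> sf; apply/is_derive_partial/is_derive_expR_comp/derivableP.
exact: smooth_derivable.
Qed.

Lemma Ck_cst k (c : R) : Ck k (fun _ : 'rV[R]_n => c).
Proof.
elim: k c => [|k IH] c; split=> //; try exact: cst_continuous.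
move=> i; split; first by move=> p; exact: derivable_cst.
by rewrite (_ : partial i _ = fun=> 0) //; apply/funext => p; exact: partial_cst.
Qed.

Lemma Ck_coord k i : Ck k (fun q : 'rV[R]_n => q 0 i).
Proof.
case: k => [|k]; split=> //; try exact: coord_continuous.
move=> j; split; first by move=> p; case: (is_derive_coord i p (delta_mx 0 j)).
rewrite (_ : partial j _ = fun=> (delta_mx 0 j : 'rV[R]_n) 0 i).
  exact: Ck_cst.
by apply/funext => p; exact: partial_coord.
Qed.

Lemma CkD k f h : Ck k f -> Ck k h -> Ck k (fun q => f q + h q).
Proof.
elim: k f h => [|k IH] f h [cf df] [ch dh].
  by split=> // p; apply: continuousD; [exact: cf|exact: ch].
split=> [p|i]; first by apply: continuousD; [exact: cf|exact: ch].
have [df1 df2] := df i; have [dh1 dh2] := dh i.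
split=> [p|]; first by apply: derivableD.
rewrite (_ : partial i _ = fun q => partial i f q + partial i h q).
  exact: IH.
by apply/funext => p; apply: deriveD.
Qed.

Lemma CkM k f h : Ck k f -> Ck k h -> Ck k (fun q => f q * h q).
Proof.
elim: k f h => [|k IH] f h fk hk.
  by split=> // p; apply: continuousM; [exact: fk.1|exact: hk.1].
have [cf df] := fk; have [ch dh] := hk.
split=> [p|i]; first by apply: continuousM; [exact: cf|exact: ch].
have [df1 df2] := df i; have [dh1 dh2] := dh i.
split=> [p|]; first by apply: derivableM.
rewrite (_ : partial i _ = fun q => f q * partial i h q + h q * partial i f q).
  (* The product rule keeps one factor undifferentiated, so its order has to be lowered by [CkS]. *)
  by apply: CkD; apply: IH => //; exact: CkS.
by apply/funext => p; apply: deriveM.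
Qed.

Lemma Ck_expR k f : Ck k f -> Ck k (fun q => expR (f q)).
Proof.
have cexp : continuous f -> continuous (fun q => expR (f q)).
  by move=> cf p; apply: continuous_comp; [exact: cf|exact: continuous_expR].
elim: k => [|k IH] fk; first by split=> //; exact/cexp/fk.1.
have [cf df] := fk; split=> [|i]; first exact: cexp.
have [df1 df2] := df i; have de p := is_derive_expR_comp _ _ _ _ (derivableP (df1 p)).
split=> [p|]; first by case: (de p).
rewrite (_ : partial i _ = fun q => expR (f q) * partial i f q).
  by apply: CkM => //; exact/IH/CkS.
by apply/funext => p; exact: (is_derive_partial _ _ _ _ (de p)).
Qed.

Lemma smooth_cst (c : R) : smooth (fun _ : 'rV[R]_n => c).
Proof. by move=> k; exact: Ck_cst. Qed.

Lemma smooth_coord i : smooth (fun q : 'rV[R]_n => q 0 i).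
Proof. by move=> k; exact: Ck_coord. Qed.

Lemma smoothD f h : smooth f -> smooth h -> smooth (fun q => f q + h q).
Proof. by move=> sf sh k; exact: CkD. Qed.

Lemma smoothM f h : smooth f -> smooth h -> smooth (fun q => f q * h q).
Proof. by move=> sf sh k; exact: CkM. Qed.

Lemma smoothN f : smooth f -> smooth (fun q => - f q).
Proof.
move=> sf; rewrite (_ : (fun q => - f q) = fun q => -1 * f q).
  by apply: smoothM => //; exact: smooth_cst.
by apply/funext => q; rewrite mulN1r.
Qed.

Lemma smooth_expR f : smooth f -> smooth (fun q => expR (f q)).
Proof. by move=> sf k; exact: Ck_expR. Qed.

Lemma partialZ (c : R) f i p : smooth f ->
  partial i (fun q => c * f q) p = c * partial i f p.
Proof.
move=> sf; rewrite partialM ?partial_cst ?mulr0 ?addr0 //.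
exact: smooth_cst.
Qed.

Lemma partialN f i p : smooth f -> partial i (fun q => - f q) p = - partial i f p.
Proof. by move=> sf; apply: deriveN; apply: smooth_derivable. Qed.

End Smooth.

(** * Tensors in the coordinate frame *)

Section Frame.
Context {R : realType} {n : nat}.
Implicit Types (g : 'rV[R]_n -> 'M[R]_n) (X Y : 'rV[R]_n -> 'rV[R]_n).
Implicit Types (p : 'rV[R]_n) (i j k l : 'I_n).

Lemma deriv_frame i (f : 'rV[R]_n -> R) : Defs.deriv (frame i) f = partial i f.
Proof.
apply/funext => p; rewrite /Defs.deriv (bigD1 i) //= big1 ?addr0 => [|k ki].
  by rewrite mxE !eqxx mul1r.
by rewrite mxE (negbTE ki) andbF mul0r.
Qed.

Lemma deriv_cst X (c : R) : Defs.deriv X (fun=> c) = fun=> 0.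
Proof.
by apply/funext => p; rewrite /Defs.deriv big1 // => i _; rewrite partial_cst mulr0.
Qed.

Lemma inner_frame g i j : inner g (frame i) (frame j) = fun p => g p i j.
Proof.
by apply/funext => p; rewrite /inner /frame -rowE trmx_delta -colE !mxE.
Qed.

Lemma inner_framer g X j p : inner g X (frame j) p = \sum_k X p 0 k * g p k j.
Proof. by rewrite /inner /frame trmx_delta -colE !mxE. Qed.

Lemma inner_framel g X i p : inner g (frame i) X p = \sum_k X p 0 k * g p i k.
Proof.
by rewrite /inner /frame -rowE !mxE; apply: eq_bigr => k _; rewrite !mxE mulrC.
Qed.

Lemma bracket_frame X i p k :
  bracket X (frame i) p 0 k = - partial i (fun q => X q 0 k) p.
Proof. by rewrite mxE deriv_frame deriv_cst sub0r. Qed.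

Lemma lie_metric_frame g X i j p :
  lie_metric g X (frame i) (frame j) p =
  \sum_k (X p 0 k * partial k (fun q => g q i j) p
          + partial i (fun q => X q 0 k) p * g p k j
          + partial j (fun q => X q 0 k) p * g p i k).
Proof.
rewrite /lie_metric inner_frame inner_framer inner_framel !big_split /=.
by congr (_ + _ + _); rewrite -sumrN; apply: eq_bigr => k _;
  rewrite bracket_frame mulNr opprK.
Qed.

Lemma nabla_frame g i X p k :
  nabla g (frame i) X p 0 k = partial i (fun q => X q 0 k) p
    + \sum_j christoffel g k i j p * X p 0 j.
Proof.
rewrite mxE deriv_frame; congr (_ + _).
rewrite (bigD1 i) //= [X in _ + X]big1 ?addr0 => [|l li].
  by apply: eq_bigr => j _; rewrite mxE !eqxx mulr1.
by apply: big1 => j _; rewrite mxE (negbTE li) andbF mulr0 mul0r.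
Qed.

Lemma nabla_frame_frame g i j p k :
  nabla g (frame i) (frame j) p 0 k = christoffel g k i j p.
Proof.
rewrite nabla_frame partial_cst add0r (bigD1 j) //= big1 ?addr0 => [|l lj].
  by rewrite mxE !eqxx mulr1.
by rewrite mxE (negbTE lj) andbF mulr0.
Qed.

(** Coordinate fields commute, so the bracket term drops out. The components of
    [nabla g (frame a) (frame b)] are Christoffel symbols, and differentiating them once more gives
    the classical formula. *)
Lemma curvature_frame g i j k p l :
  curvature g (frame i) (frame j) (frame k) p 0 l =
  partial i (christoffel g l j k) p - partial j (christoffel g l i k) p
  + \sum_m (christoffel g l i m p * christoffel g m j k p
            - christoffel g l j m p * christoffel g m i k p).
Proof.
have bracket0 : bracket (frame i) (frame j) p = 0 :> 'rV[R]_n.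
  by apply/rowP => m; rewrite bracket_frame partial_cst oppr0 mxE.
have nabla0 Z : nabla g (bracket (frame i) (frame j)) Z p = 0.
  apply/rowP => m; rewrite [RHS]mxE mxE /Defs.deriv bracket0 !big1 ?addr0 // => q _.
    by rewrite big1 // => s _; rewrite mxE mulr0 mul0r.
  by rewrite mxE mul0r.
have E a b c : (fun q => nabla g (frame a) (frame b) q 0 c)
    = christoffel g c a b by apply/funext => ?; rewrite nabla_frame_frame.
rewrite /curvature nabla0 subr0 mxE [X in _ + X]mxE !nabla_frame !E //.
under eq_bigr do rewrite nabla_frame_frame.
under [X in - (_ + X)]eq_bigr do rewrite nabla_frame_frame.
by rewrite sumrB opprD addrACA.
Qed.

Lemma ricci_frame g i j p : ricci g (frame i) (frame j) p =
  \sum_k (partial k (christoffel g k i j) p - partial i (christoffel g k k j) p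
  + \sum_m (christoffel g k k m p * christoffel g m i j p
            - christoffel g k i m p * christoffel g m k j p)).
Proof.
by rewrite /ricci /mxtrace; apply: eq_bigr => k _; rewrite mxE curvature_frame.
Qed.

End Frame.

(** * Curvature of the type B metric *)

Section TypeB.
Context {R : realType}.
Variable mu : R.
Implicit Types (p : 'rV[R]_4) (i j k l : 'I_4).

Lemma ord4_ind (P : 'I_4 -> Prop) :
  P ix -> P iy -> P iu -> P iv -> forall i, P i.
Proof.
move=> Px Py Pu Pv [[|[|[|[|//]]]] lti];
  by rewrite (bool_irrelevance lti isT).
Qed.

Lemma sum_ord4 (F : 'I_4 -> R) : \sum_i F i = F ix + F iy + F iu + F iv.
Proof.
rewrite !big_ord_recl big_ord0 addr0 !addrA.
by congr (F _ + F _ + F _ + F _); apply: val_inj.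
Qed.

(** The exponent w_i of the rescaled frame E_i = e^{w_i} d_i; [dweight l i] below is its derivative
    d_l w_i. *)
Definition weight i p : R :=
  match val i with 2 => p 0 ix | 3 => p 0 iy | _ => 0 end.

Definition dweight l i : R :=
  match val l, val i with 0, 2 | 1, 3 => 1 | _, _ => 0 end.

(** The constants g(E_i, E_j); [gram_inv_coef] holds the inverse matrix. *)
Definition gram_coef i j : R :=
  match val i, val j with
  | 0, 0 | 1, 1 => mu
  | 0, 1 | 1, 0 => mu / 2
  | 0, 3 | 3, 0 | 1, 2 | 2, 1 => 1
  | 0, 2 | 2, 0 | 1, 3 | 3, 1 => 2^-1
  | _, _ => 0
  end.

Definition gram_inv_coef i j : R :=
  match val i, val j with
  | 0, 2 | 2, 0 | 1, 3 | 3, 1 => - (2 / 3)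
  | 0, 3 | 3, 0 | 1, 2 | 2, 1 => 4 / 3
  | 2, 2 | 3, 3 => - (4 / 3 * mu)
  | 2, 3 | 3, 2 => 2 / 3 * mu
  | _, _ => 0
  end.

(* Upper index first, as in [christoffel]. *)
Definition christoffel_coef k i j : R :=
  match val k, val i, val j with
  | 0, 0, 0 | 1, 1, 1 => 1 / 3
  | 0, 0, 1 | 0, 1, 0 | 1, 0, 1 | 1, 1, 0 => - (1 / 3)
  | 0, 1, 1 | 1, 0, 0 => - (2 / 3)
  | 2, 0, 0 | 3, 1, 1 => 2 / 3 * mu
  | 2, 0, 1 | 2, 1, 0 | 3, 0, 1 | 3, 1, 0 => 1 / 3 * mu
  | 2, 1, 1 | 3, 0, 0 => - (1 / 3 * mu)
  | 2, 0, 2 | 2, 2, 0 | 3, 1, 3 | 3, 3, 1 => - (2 / 3)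
  | 2, 1, 2 | 2, 2, 1 | 3, 0, 3 | 3, 3, 0 => - (1 / 3)
  | 2, 0, 3 | 2, 3, 0 | 3, 1, 2 | 3, 2, 1 => 2 / 3
  | 2, 1, 3 | 2, 3, 1 | 3, 0, 2 | 3, 2, 0 => 1 / 3
  | _, _, _ => 0
  end.

Lemma smooth_weight i : smooth (weight i).
Proof.
by elim/ord4_ind: i; [exact: smooth_cst|exact: smooth_cst
  |exact: smooth_coord|exact: smooth_coord].
Qed.

Lemma partial_weight l i p : partial l (weight i) p = dweight l i.
Proof.
elim/ord4_ind: i; rewrite /weight /= ?partial_cst ?partial_coord ?mxE.
- by elim/ord4_ind: l.
- by elim/ord4_ind: l.
- by elim/ord4_ind: l.
- by elim/ord4_ind: l.
Qed.

(* Weights depend on x and y only, whose own weights vanish. *)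
Lemma dweight_expR l i p (t : R) :
  dweight l i * expR (weight l p + t) = dweight l i * expR t.
Proof.
by elim/ord4_ind: l; elim/ord4_ind: i; rewrite /dweight /weight /= ?add0r ?mul0r.
Qed.

Lemma symprodE (a b : 'rV[R]_4) i j :
  symprod a b i j = 2^-1 * (a 0 i * b 0 j + b 0 i * a 0 j).
Proof. by rewrite !mxE !big_ord1 !mxE. Qed.

Lemma typeB_metricE p i j :
  typeB_metric mu p i j = gram_coef i j * expR (- weight i p - weight j p).
Proof.
rewrite /typeB_metric.
(* Only the outer sums and scalings are taken apart, so that [symprodE] still meets whole symmetric
   products. *)
rewrite [LHS]mxE [X in X + _]mxE [X in X + _ + _]mxE [X in _ + X + _]mxE.
rewrite [X in _ + _ + X]mxE [X in _ * X + _ + _]mxE [X in _ * (X + _) + _ + _]mxE.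
rewrite !symprodE !mxE.
by elim/ord4_ind: i; elim/ord4_ind: j; rewrite /gram_coef /weight /=
  ?(oppr0, add0r, addr0, expR0) //; field.
Qed.

Lemma gram_coef_mul_inv i k :
  \sum_j gram_coef i j * gram_inv_coef j k = (i == k)%:R.
Proof.
by elim/ord4_ind: i; elim/ord4_ind: k; rewrite sum_ord4 /gram_coef /gram_inv_coef /=; field.
Qed.

Definition metric_inv p : 'M[R]_4 :=
  \matrix_(k, l) (gram_inv_coef k l * expR (weight k p + weight l p)).

Lemma mul_metric_inv p : typeB_metric mu p *m metric_inv p = 1%:M.
Proof.
apply/matrixP => i k; rewrite !mxE.
transitivity ((\sum_j gram_coef i j * gram_inv_coef j k) * expR (weight k p - weight i p)).
  rewrite mulr_suml; apply: eq_bigr => j _; rewrite typeB_metricE mxE.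
  by rewrite mulrACA -expRD; congr (_ * expR _); ring.
rewrite gram_coef_mul_inv; case: eqP => [->|_]; last by rewrite mul0r.
by rewrite subrr expR0 mulr1.
Qed.

Lemma typeB_metric_unit p : typeB_metric mu p \in unitmx.
Proof. by have [] := mulmx1_unit (mul_metric_inv p). Qed.

Lemma invmx_typeB p k l :
  invmx (typeB_metric mu p) k l = gram_inv_coef k l * expR (weight k p + weight l p).
Proof.
rewrite -[invmx _]mulmx1 -(mul_metric_inv p) mulmxA mulVmx ?typeB_metric_unit //.
by rewrite mul1mx mxE.
Qed.

Lemma gram_coefC i j : gram_coef i j = gram_coef j i.
Proof. by elim/ord4_ind: i; elim/ord4_ind: j. Qed.

Lemma smooth_cexp (c : R) (f : 'rV[R]_4 -> R) :
  smooth f -> smooth (fun q => c * expR (f q)).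
Proof. by move=> sf; apply: smoothM; [exact: smooth_cst|exact: smooth_expR]. Qed.

Lemma typeB_pseudo_riemannian : pseudo_riemannian (typeB_metric mu).
Proof.
split=> [i j|p].
  rewrite (_ : (fun p => _) =
    fun p => gram_coef i j * expR (- weight i p - weight j p)).
    by apply: smooth_cexp; apply: smoothD; apply: smoothN; exact: smooth_weight.
  by apply/funext => p; exact: typeB_metricE.
split; last exact: typeB_metric_unit.
by apply/matrixP => i j; rewrite mxE !typeB_metricE gram_coefC addrC.
Qed.

Lemma partial_typeB l i j p : partial l (fun q => typeB_metric mu q i j) p =
  - gram_coef i j * (dweight l i + dweight l j) * expR (- weight i p - weight j p).
Proof.
rewrite (_ : (fun q => _) = fun q => gram_coef i j * expR (- weight i q - weight j q)).
  have sN a := smoothN _ (smooth_weight a).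
  rewrite partialZ ?partial_expR ?partialD ?partialN ?partial_weight;
    do ?[exact: smooth_weight|exact: sN|apply: smoothD|apply: smooth_expR].
  ring.
by apply/funext => q; exact: typeB_metricE.
Qed.

(** The Christoffel formula stripped of its exponentials. Each derivative of the metric contributes
    a factor - ([dweight] + [dweight]), which reverses the usual signs. The 64 index triples are
    checked one by one. *)
Lemma christoffel_coefE k i j : christoffel_coef k i j = 2^-1 * \sum_l gram_inv_coef k l *
  (gram_coef i j * (dweight l i + dweight l j)
   - gram_coef j l * (dweight i j + dweight i l)
   - gram_coef i l * (dweight j i + dweight j l)).
Proof.
by elim/ord4_ind: k; elim/ord4_ind: i; elim/ord4_ind: j;
  rewrite sum_ord4 /christoffel_coef /gram_inv_coef /gram_coef /dweight /=; field.
Qed.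

(** After w_l cancels, the term differentiated along d_i has exponent w_k - w_j, off by w_i from the
    common exponent. It carries a factor [dweight i _], which vanishes unless w_i = 0, so
    [dweight_expR] repairs the mismatch. The terms along d_j and d_l are treated alike. *)
Lemma christoffel_typeB k i j p : christoffel (typeB_metric mu) k i j p =
  christoffel_coef k i j * expR (weight k p - weight i p - weight j p).
Proof.
rewrite /christoffel christoffel_coefE -mulrA mulr_suml; congr (_ * _).
apply: eq_bigr => l _; rewrite invmx_typeB !partial_typeB.
set wk := weight k p; set wi := weight i p.
set wj := weight j p; set wl := weight l p.
set E := expR (wk - wi - wj).
have Di a : dweight i a * expR (wk + wl + (- wj - wl)) = dweight i a * E.
  by rewrite -[RHS](dweight_expR i a p); congr (_ * expR _); rewrite -/wi; ring.
have Dj a : dweight j a * expR (wk + wl + (- wi - wl)) = dweight j a * E.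
  by rewrite -[RHS](dweight_expR j a p); congr (_ * expR _); rewrite -/wj; ring.
have Dl a : dweight l a * expR (wk + wl + (- wi - wj)) = dweight l a * E.
  by rewrite -[RHS](dweight_expR l a p); congr (_ * expR _); rewrite -/wl; ring.
have distr m a b s : expR (wk + wl) * (m * ((a + b) * expR s)) =
    m * (a * expR (wk + wl + s) + b * expR (wk + wl + s)).
  by rewrite [expR (_ + s)]expRD; ring.
rewrite -!mulrA [X in _ * X = _]mulrBr [X in _ * (X - _) = _]mulrDr.
rewrite !distr !(Di, Dj, Dl); ring.
Qed.

Lemma ricci_typeB i j p : ricci (typeB_metric mu) (frame i) (frame j) p =
   match val i, val j with
   | 0, 0 | 1, 1 => - (4 / 3)
   | 0, 1 | 1, 0 => - (2 / 3)
   | _, _ => 0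
   end.
Proof.
have chrisf a b c : christoffel (typeB_metric mu) a b c =
    fun q => christoffel_coef a b c * expR (weight a q - weight b q - weight c q).
  by apply/funext => q; exact: christoffel_typeB.
have dchris l a b c : partial l (christoffel (typeB_metric mu) a b c) p =
    christoffel_coef a b c * (dweight l a - dweight l b - dweight l c) *
    expR (weight a p - weight b p - weight c p).
  rewrite chrisf.
  have sN m := smoothN _ (smooth_weight m).
  rewrite partialZ ?partial_expR ?partialD ?partialN ?partial_weight;
    do ?[exact: smooth_weight|exact: sN|apply: smoothD|apply: smooth_expR].
  ring.
set E := expR (- weight i p - weight j p).
(* In the quadratic terms the weights of k and m cancel and leave exactly E. The derivative terms
   have other exponents, which [dweight_expR] again adjusts to E. What remains inside the sum is
   constant. *)
transitivity (E * \sum_k (- (christoffel_coef k i j * (dweight k i + dweight k j))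
    + christoffel_coef k k j * dweight i j
  + \sum_m (christoffel_coef k k m * christoffel_coef m i j
             - christoffel_coef k i m * christoffel_coef m k j))).
  rewrite ricci_frame mulr_sumr; apply: eq_bigr => k _.
  rewrite mulrDr mulr_sumr; congr (_ + _); last first.
    apply: eq_bigr => m _; rewrite !christoffel_typeB mulrBr.
    congr (_ - _); rewrite mulrACA -expRD mulrC /E; congr (expR _ * _); ring.
  have Dk a : dweight k a * expR (weight k p - weight i p - weight j p) =
      dweight k a * E.
    by rewrite -[RHS](dweight_expR k a p) /E addrA.
  have Di : dweight i j * expR (weight k p - weight k p - weight j p) =
      dweight i j * E.
    rewrite -[RHS](dweight_expR i j p) /E; congr (_ * expR _); ring.
  have D0 : dweight k k = 0 by elim/ord4_ind: (k).
  rewrite !dchris D0.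
  transitivity (- christoffel_coef k i j *
      (dweight k i * expR (weight k p - weight i p - weight j p) +
       dweight k j * expR (weight k p - weight i p - weight j p)) +
      christoffel_coef k k j *
      (dweight i j * expR (weight k p - weight k p - weight j p))).
    ring.
  rewrite !Dk Di; ring.
rewrite /E; clear.
elim/ord4_ind: i; elim/ord4_ind: j; rewrite !sum_ord4 /christoffel_coef /dweight /weight /=.
(* E is 1 when i and j are among x and y; in the other cases the constant multiplying E is 0. *)
all: rewrite ?oppr0 ?addr0 ?expR0; by field.
Qed.

End TypeB.

(** * Solitons *)

Ltac solve_smooth := do ?[assumption | exact: smooth_cst | exact: smooth_coord
  | apply: smoothD | apply: smoothN | apply: smoothM | apply: smooth_expR].

Section Solitons.
Context {R : realType}.
Implicit Types (X : 'rV[R]_4 -> 'rV[R]_4) (p : 'rV[R]_4) (i j k l : 'I_4).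

Lemma lie_typeB mu X i j p : lie_metric (typeB_metric mu) X (frame i) (frame j) p =
  \sum_k (- (gram_coef mu i j * (dweight k i + dweight k j) * X p 0 k *
             expR (- weight i p - weight j p))
    + partial i (fun q => X q 0 k) p * (gram_coef mu k j * expR (- weight k p - weight j p))
    + partial j (fun q => X q 0 k) p * (gram_coef mu i k * expR (- weight i p - weight k p))).
Proof.
rewrite lie_metric_frame; apply: eq_bigr => k _.
by rewrite partial_typeB !typeB_metricE; congr (_ + _ + _); ring.
Qed.

(* With T = d_i U, symmetry for U and V gives T_i = U - 4/9 and
   T_j = (U + T) / 2 - 2/9; symmetry for T then reads 2/3 = - 2/9. *)
Lemma overdetermined_system (n : nat) (i j : 'I_n) (U V : 'rV[R]_n -> R) :
  smooth U -> smooth V ->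
  ~ (forall p : 'rV[R]_n, [/\ partial i V p = 2 / 3 - 2^-1 * U p - 2^-1 * partial i U p,
    partial j V p = - V p - U p - partial i U p &
    partial j U p = 2 / 3 + 2^-1 * U p + 2^-1 * partial i U p]).
Proof.
move=> sU sV eqn.
(* The existential makes T opaque, so that it serves as a new unknown function in the rewriting
   below. *)
have [T fUx] : exists T, partial i U = T by exists (partial i U).
have sT : smooth T by rewrite -fUx; exact: smooth_partial.
have fVx : partial i V = fun q => 2 / 3 + - (2^-1 * U q) + - (2^-1 * T q).
  by apply/funext => q; have [-> _ _] := eqn q; rewrite fUx.
have fVy : partial j V = fun q => - V q + - U q + - T q.
  by apply/funext => q; have [_ -> _] := eqn q; rewrite fUx.
have fUy : partial j U = fun q => 2 / 3 + 2^-1 * U q + 2^-1 * T q.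
  by apply/funext => q; have [_ _ ->] := eqn q; rewrite fUx.
have TxTy (p : 'rV[R]_n) : partial i T p = U p - 4 / 9 /\
    partial j T p = 2^-1 * U p + 2^-1 * T p - 2 / 9.
  have := congr1 (fun F => F p) (partialC U i j sU).
  have := congr1 (fun F => F p) (partialC V i j sV).
  rewrite /= fVx fVy fUy fUx.
  rewrite !(partialD, partialN, partialZ, partial_cst); solve_smooth.
  rewrite fVx fUy fUx.
  move: (partial i T p) (partial j T p) (U p) (V p) (T p).
  by clear => *; split; lra.
have fTx : partial i T = fun q => U q + - (4 / 9).
  by apply/funext => q; have [] := TxTy q.
have fTy : partial j T = fun q => 2^-1 * U q + 2^-1 * T q + - (2 / 9).
  by apply/funext => q; have [] := TxTy q.
have := congr1 (fun F => F 0) (partialC T i j sT).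
rewrite /= fTx fTy !(partialD, partialN, partialZ, partial_cst); solve_smooth.
rewrite fTx fUy fUx.
by move: (U 0) (T 0); clear => *; lra.
Qed.

(** The (x,x), (x,y) and (y,y) components give three linear equations for the four first x- and
    y-derivatives of U and V. Solving them in terms of d_x U yields the system excluded by
    [overdetermined_system]. *)
Lemma no_soliton_mu0 X (lambda : R) : smooth_field X ->
  ~ ricci_soliton_eq (typeB_metric 0) X lambda.
Proof.
move=> sX solX.
pose U (q : 'rV[R]_4) := expR (- q 0 ix) * X q 0 iu.
pose V (q : 'rV[R]_4) := expR (- q 0 iy) * X q 0 iv.
have sU : smooth U by have := sX iu; rewrite /U => ?; solve_smooth.
have sV : smooth V by have := sX iv; rewrite /V => ?; solve_smooth.
(* The product rule read backwards: it trades the derivatives of X^u, and next of X^v, for those of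
   U and V. *)
have dU l p : expR (- p 0 ix) * partial l (fun q => X q 0 iu) p =
    partial l U p + (delta_mx 0 l : 'rV[R]_4) 0 ix * U p.
  have := sX iu; rewrite /U => sXu.
  rewrite partialM ?partial_expR ?partialN ?partial_coord; solve_smooth.
  ring.
have dV l p : expR (- p 0 iy) * partial l (fun q => X q 0 iv) p =
    partial l V p + (delta_mx 0 l : 'rV[R]_4) 0 iy * V p.
  have := sX iv; rewrite /V => sXv.
  rewrite partialM ?partial_expR ?partialN ?partial_coord; solve_smooth.
  ring.
apply: (overdetermined_system _ ix iy U V sU sV) => p.
have := solX p ix ix; have := solX p ix iy; have := solX p iy iy.
rewrite !lie_typeB !ricci_typeB !inner_frame !typeB_metricE !sum_ord4.
rewrite /gram_coef /dweight /weight /= !(oppr0, addr0, add0r, expR0).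
have := dU ix p; have := dU iy p; have := dV ix p; have := dV iy p.
rewrite !mxE /= !(mul0r, mulr0, mul1r, mulr1, oppr0, add0r, addr0).
move: (partial ix U p) (partial iy U p) (partial ix V p) (partial iy V p).
move: (U p) (V p) (expR (- p 0 ix)) (expR (- p 0 iy)).
move: (partial ix (fun q => X q 0 iu) p) (partial iy (fun q => X q 0 iu) p).
move: (partial ix (fun q => X q 0 iv) p) (partial iy (fun q => X q 0 iv) p).
by clear => *; split; lra.
Qed.

End Solitons.

(** * The explicit soliton field for nonzero mu *)

Section Field.
Context {R : realType} (mu W1 W2 W3 : R).
Implicit Types (p : 'rV[R]_4) (i j k l : 'I_4).

Let a : R := - W1 + 2 * W2.
Let b : R := 2 * W1 - W2.
Let c : R := 4 / (3 * mu).
Let X := typeB_field mu W1 W2 W3.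

Lemma typeB_fieldE k p : X p 0 k =
  match val k with
  | 0 => a | 1 => b | 2 => (a - c) * p 0 iu | _ => (b - c) * p 0 iv + W3
  end.
Proof.
by rewrite /X /typeB_field /frame !mxE; elim/ord4_ind: k; rewrite /= -/a -/b -/c; ring.
Qed.

Lemma smooth_typeB_field : smooth_field X.
Proof.
move=> k; rewrite (funext (typeB_fieldE k)).
by elim/ord4_ind: k; rewrite /=; solve_smooth.
Qed.

Lemma partial_typeB_field l k p : partial l (fun q => X q 0 k) p =
  match val l, val k with 2, 2 => a - c | 3, 3 => b - c | _, _ => 0 end.
Proof.
rewrite (funext (typeB_fieldE k)).
by elim/ord4_ind: k; elim/ord4_ind: l; rewrite /=
  ?(partialD, partialZ, partial_cst, partial_coord) ?mxE /=
  ?(mulr0, mulr1, addr0); solve_smooth.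
Qed.

(** Put q = dx^2 + dx dy + dy^2. The parts of X with coefficients a, b and W3 are Killing fields,
    while - c (u d_u + v d_v) scales the du and dv terms, so L_X g = - c (g - mu q). The Ricci
    tensor is - (4/3) q, and c mu = 4/3 leaves - c g. *)
Lemma typeB_soliton_eq : mu != 0 ->
  ricci_soliton_eq (typeB_metric mu) X (- (4 / (3 * mu))).
Proof.
move=> mu0 p i j.
rewrite lie_typeB ricci_typeB inner_frame typeB_metricE sum_ord4.
rewrite !partial_typeB_field !typeB_fieldE -/c.
have cmu : c * mu = 4 / 3 by rewrite /c; field.
by elim/ord4_ind: i; elim/ord4_ind: j;
  rewrite /gram_coef /dweight /weight /= ?(oppr0, addr0, add0r, expR0);
  rewrite ?(mul0r, mulr0, mulr1, mul1r, oppr0, addr0, add0r, subr0, sub0r)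
    ?(mulrA (- c)) ?mulNr ?(mulrA c) ?cmu //; field.
Qed.

Lemma typeB_not_gradient : mu != 0 -> ~ gradient_field (typeB_metric mu) X.
Proof.
move=> mu0 [f sf gf].
(* If X is the gradient of f, then df is the one-form dual to X; its four components are made
   explicit below. *)
have df j p : partial j f p =
    \sum_k X p 0 k * (gram_coef mu k j * expR (- weight k p - weight j p)).
  have -> : partial j f p = (X p *m typeB_metric mu p) 0 j.
    by rewrite gf mulmxKV ?typeB_metric_unit // mxE.
  by rewrite mxE; apply: eq_bigr => k _; rewrite typeB_metricE.
have E i j : partial i (partial j f) 0 = partial j (partial i f) 0.
  by rewrite partialC.
have fx : partial ix f = fun p => mu * (a + b / 2) +
    2^-1 * (a - c) * (p 0 iu * expR (- p 0 ix)) +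
    ((b - c) * p 0 iv + W3) * expR (- p 0 iy).
  apply/funext => p; rewrite df sum_ord4 !typeB_fieldE /gram_coef /weight /=.
  by rewrite !(oppr0, addr0, add0r, expR0); field.
have fy : partial iy f = fun p => mu * (a / 2 + b) +
    (a - c) * (p 0 iu * expR (- p 0 ix)) +
    2^-1 * (((b - c) * p 0 iv + W3) * expR (- p 0 iy)).
  apply/funext => p; rewrite df sum_ord4 !typeB_fieldE /gram_coef /weight /=.
  by rewrite !(oppr0, addr0, add0r, expR0); field.
have fu : partial iu f = fun p => (a / 2 + b) * expR (- p 0 ix).
  apply/funext => p; rewrite df sum_ord4 !typeB_fieldE /gram_coef /weight /=.
  by rewrite !(oppr0, addr0, add0r, expR0); field.
have fv : partial iv f = fun p => (a + b / 2) * expR (- p 0 iy).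
  apply/funext => p; rewrite df sum_ord4 !typeB_fieldE /gram_coef /weight /=.
  by rewrite !(oppr0, addr0, add0r, expR0); field.
have c0 : c != 0 by rewrite /c mulf_neq0 ?invr_eq0 ?mulf_neq0 ?pnatr_eq0.
(* At the origin all exponentials are 1. The planes (y,u) and (x,v) give a = c and b = c, and (x,u)
   gives c = 2 (a + b); together c = 4 c, against c != 0. *)
have := E ix iu; have := E iy iu; have := E ix iv; rewrite fx fy fu fv.
rewrite !(partialD, partialM, partialZ, partialN, partial_expR, partial_cst,
  partial_coord); solve_smooth.
rewrite !mxE /= !(oppr0, expR0, mulr0, mulr1, mul0r, addr0, add0r) => e1 e2 e3.
by move/eqP: c0; apply; lra.
Qed.

End Field.

Theorem theorem2 (R : realType) (mu : R) :
  [/\ (exists X : 'rV[R]_4 -> 'rV[R]_4, ricci_soliton (typeB_metric mu) X)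
        <-> mu <> 0,
      mu = 0 ->
        ~ (exists (X : 'rV[R]_4 -> 'rV[R]_4) (lambda : R),
             smooth_field X /\ ricci_soliton_eq (typeB_metric mu) X lambda)
    & mu <> 0 ->
        forall W1 W2 W3 : R,
          ricci_soliton (typeB_metric mu) (typeB_field mu W1 W2 W3) /\
          ~ gradient_field (typeB_metric mu) (typeB_field mu W1 W2 W3)].
Proof.
have none : mu = 0 -> ~ (exists (X : 'rV[R]_4 -> 'rV[R]_4) (lambda : R),
    smooth_field X /\ ricci_soliton_eq (typeB_metric mu) X lambda).
  by move=> -> [X [lambda [sX /no_soliton_mu0]]]; apply.
have some W1 W2 W3 : mu <> 0 ->
    ricci_soliton (typeB_metric mu) (typeB_field mu W1 W2 W3).
  move=> /eqP mu0; split.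
  - exact: typeB_pseudo_riemannian.
  - exact: smooth_typeB_field.
  - by exists (- (4 / (3 * mu))); exact: typeB_soliton_eq.
split=> // [|mu0 W1 W2 W3].
  split=> [[X [_ sX [lambda eqX]]] mu0|mu0]; first by apply: none => //; exists X, lambda.
  (* Any member of the family would do; this one is - 4 / (3 mu) (u d_u + v d_v). *)
  by exists (typeB_field mu 0 0 0); exact: some.
split; first exact: some.
by apply: typeB_not_gradient; apply/eqP.
Qed.
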